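(* Let $K=(K_{j,k})_{j,k\in\mathbb{N}_0}$ be a symmetric interaction kernel satisfying $$C_1\left(j^2k^\alpha+j^\alpha k^2\right)\le K_{j,k}\le Cj^2k^2\qquad\text{for all }(j,k)\in\mathbb{N}_0\times\mathbb{N}_0,$$ where $1<\alpha\le2$ and $C,C_1>0$. Assume further that $M_\alpha(f(0))>0$ and $f(0)=(f_j(0))_{j\ge0}\in Y_{2+\alpha}^+$. Then there is no global mass-conserving solution $(f_j)_{j\ge0}$ with values in $Y_2^+$ on $[0,\infty)$ of the EDG system with kernel $K$ and initial data $f(0)$.
   Context: $\mathbb{N}=\{1,2,\dots\}$, $\mathbb{N}_0=\mathbb{N}\cup\{0\}$. For $r\ge0$, $Y_r^+$ is the set of sequences $f=(f_j)_{j\ge0}$ of non-negative reals with $\|f\|_r=\sum_{j\ge0}j^rf_j<\infty$. $M_p(f)=\sum_{j\ge0}j^pf_j$ for $p>0$. Symmetric means $K_{j,k}=K_{k,j}$. The exchange-driven growth (EDG) system with kernel $K$ is $$\dot f_j=f_{j+1}\sum_{k=0}^\infty K_{j+1,k}f_k-f_j\sum_{k=0}^\infty K_{j,k}f_k-f_j\sum_{k=1}^\infty K_{k,j}f_k+f_{j-1}\sum_{k=1}^\infty K_{k,j-1}f_k\quad(j\in\mathbb{N}),$$ $$\dot f_0=f_1\sum_{k=0}^\infty K_{1,k}f_k-f_0\sum_{k=1}^\infty K_{k,0}f_k,$$ with prescribed initial data $f_j(0)$. Solution with values in $Y_2^+$ on $[0,T)$ (mild solution): a function $f:[0,T)\to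 Y_2^+$ with initial value $f(0)$ such that (1) each $f_j:[0,T)\to[0,\infty)$ is continuous and $\sup_{t\in[0,T)}\|f(t)\|_2<\infty$; (2) $\int_0^t\sum_{k=0}^\infty K_{j,k}f_k(s)\,ds<\infty$ for all $j\in\mathbb{N}_0$, $t\in[0,T)$; (3) the EDG equations hold in time-integrated form for all $j\in\mathbb{N}_0$, $t\in[0,T)$. A global solution on $[0,\infty)$ is a function on $[0,\infty)$ whose restriction to $[0,T)$ is such a solution for every $T\in(0,\infty)$; it is mass-conserving if $M_1(f(t))=M_1(f(0))$ for all $t\ge0$. *)

(* Defs.v *)
From HB Require Import structures.
From mathcomp Require Import all_boot all_order all_algebra.
From mathcomp Require Import all_classical all_reals all_analysis.

Set Implicit Arguments.
Unset Strict Implicit.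
Unset Printing Implicit Defensive.

Import Order.TTheory GRing.Theory Num.Theory.
Import numFieldNormedType.Exports.

Local Open Scope classical_set_scope.
Local Open Scope ring_scope.

(* The moment M_p(f) = sum_j j^p f_j, which is also the norm ||f||_p of Y_p^+;
   it may be +oo. The power satisfies 0 `^ 0 = 1 and 0 `^ p = 0 for p != 0. *)
Definition moment (R : realType) (p : R) (f : nat -> R) : \bar R :=
  (\sum_(0 <= j <oo) (j%:R `^ p * f j)%:E)%E.

Definition Yplus (R : realType) (r : R) : set (nat -> R) :=
  [set f | (forall j, 0 <= f j) /\ (moment r f < +oo)%E].

Definition symmetric_kernel (R : realType) (K : nat -> nat -> R) : Prop :=
  forall j k, K j k = K k j.

(* K j k is the rate at which a cluster of size j exports a particle to one of
   size k: the first index is the exporter, so sums over it start at 1. *)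
Definition export_rate (R : realType) (K : nat -> nat -> R) (f : nat -> R)
    (j : nat) : \bar R :=
  (\sum_(0 <= k <oo) (K j k * f k)%:E)%E.

Definition import_rate (R : realType) (K : nat -> nat -> R) (f : nat -> R)
    (j : nat) : \bar R :=
  (\sum_(1 <= k <oo) (K k j * f k)%:E)%E.

Definition edg_rhs (R : realType) (K : nat -> nat -> R) (f : nat -> R)
    (j : nat) : \bar R :=
  match j with
  | 0%N => ((f 1%N)%:E * export_rate K f 1
            - (f 0%N)%:E * import_rate K f 0)%E
  | i.+1 => ((f i.+2)%:E * export_rate K f i.+2
             - (f i.+1)%:E * export_rate K f i.+1
             - (f i.+1)%:E * import_rate K f i.+1
             + (f i)%:E * import_rate K f i)%E
  end.

(* Mild solution on [0, T) with values in Y_2^+ and initial value f0; f t j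
   stands for f_j(t), and only the values at times t in [0, T) matter. The
   integrals are Lebesgue integrals with values in \bar R, so the integrated
   equation, whose left-hand side is finite, forces its integral to be finite. *)
Record edg_solution (R : realType) (K : nat -> nat -> R) (f0 : nat -> R)
    (T : R) (f : R -> nat -> R) : Prop := EDGSolution {
  edg_init : f 0 = f0;
  edg_Y2 : forall t : R, t \in `[0, T[ -> Yplus 2 (f t);
  edg_continuous : forall j, {within `[0, T[, continuous (fun t => f t j)};
  edg_bounded :
    (ereal_sup [set moment 2%R (f t) | t in `[0%R, T[%classic] < +oo)%E;
  edg_integrable : forall j (t : R), t \in `[0, T[ ->
    (\int[lebesgue_measure]_(s in `[0%R, t]) export_rate K (f s) j < +oo)%E;
  edg_equation : forall j (t : R), t \in `[0, T[ ->
    ((f t j)%:E = (f 0%R j)%:E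
       + \int[lebesgue_measure]_(s in `[0%R, t]) edg_rhs K (f s) j)%E
}.

Definition edg_global_solution (R : realType) (K : nat -> nat -> R)
    (f0 : nat -> R) (f : R -> nat -> R) : Prop :=
  forall T : R, 0 < T -> edg_solution K f0 T f.

Definition mass_conserving (R : realType) (f : R -> nat -> R) : Prop :=
  forall t : R, 0 <= t -> moment 1 (f t) = moment 1 (f 0).

(* Main.v *)
(** Since K vanishes when one of its arguments is 0, the EDG system is a discrete
    diffusion: with g_j = f_j sum_k K_{j,k} f_k one has g_0 = 0 and
    f_j' = g_{j+1} - 2 g_j + g_{j-1}. Testing it against the ramps (j - i)_+ and
    using mass conservation gives
      sum_j (j - i)_+ f_j(t) >= int_0^t g_i ds,
    and weighting by i^(alpha-2), where
    sum_i i^(alpha-2) (j - i)_+ <= j^alpha / (alpha - 1), yields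
      M_alpha(f(t)) >= (alpha - 1) int_0^t sum_i i^(alpha-2) g_i ds
                    >= (alpha - 1) C1 int_0^t M_alpha(f(s))^2 ds.
    As M_alpha >= M_1 > 0 is bounded below, M_alpha becomes infinite in finite
    time, which contradicts f(t) being in Y_2^+. *)
Require Import Defs.
From HB Require Import structures.
From mathcomp Require Import all_boot all_order all_algebra.
From mathcomp Require Import all_classical all_reals all_analysis.
From mathcomp Require Import measurable_realfun ring lra zify.

Set Implicit Arguments.
Unset Strict Implicit.
Unset Printing Implicit Defensive.

Import Order.TTheory GRing.Theory Num.Theory.
Import numFieldNormedType.Exports.

Local Open Scope classical_set_scope.
Local Open Scope ring_scope.

(** * Elementary estimates for powers and increments *)

(** The concave function x^b lies below its tangent at y. This is Young's inequality x^b y^(1-b) <=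
    b x + (1-b) y with exponents 1/b and 1/(1-b), divided by y^(1-b); b = 1 degenerates and is split
    off. *)
Lemma powR_tangent_le (R : realType) (b x y : R) :
  0 < b <= 1 -> 0 <= x -> 0 < y -> x `^ b <= y `^ (b - 1) * (y - b * (y - x)).
Proof.
move=> /andP[b0 b1] x0 y0.
have [->|bn1] := eqVneq b 1; first by rewrite subrr powRr0 powRr1//; lra.
have b1' : 0 < 1 - b by rewrite subr_gt0 lt_neqAle bn1.
have := @conjugate_powR R (x `^ b) (y `^ (1 - b)) b^-1 (1 - b)^-1
  (powR_ge0 _ _) (powR_ge0 _ _).
rewrite !invr_gt0 !invrK => /(_ b0 b1'); rewrite addrC subrK => /(_ erefl).
rewrite -!powRrM !mulfV ?gt_eqF// !powRr1 ?(ltW y0)// => le_amgm.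
have -> : y - b * (y - x) = x * b + y * (1 - b) by ring.
rewrite -(opprB 1 b) powRN mulrC ler_pdivlMr ?powR_gt0//.
Qed.

(** The tangent at n+1 evaluated at n gives b (n+1)^(b-1) <= (n+1)^b - n^b, which telescopes. *)
Lemma sum_powR_le (R : realType) (b : R) (n : nat) :
  0 < b <= 1 -> \sum_(i < n) i.+1%:R `^ (b - 1) <= b^-1 * n%:R `^ b.
Proof.
move=> /[dup] b01 /andP[b0 b1]; elim: n => [|n IHn].
  by rewrite big_ord0 mulr_ge0 ?powR_ge0// invr_ge0 ltW.
rewrite big_ord_recr /=; apply: le_trans (lerD IHn (lexx _)) _.
have := @powR_tangent_le R b n%:R n.+1%:R b01 (ler0n _ _) (ltr0Sn _ _).
rewrite -[X in b * (X - _)]natr1 [n%:R + 1 - _]addrAC subrr add0r mulr1 mulrBr.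
rewrite [_ * n.+1%:R]mulrC mulr_powRB1// => tangent.
rewrite -(ler_pM2l b0) mulrDr !mulVKf ?gt_eqF//.
by move: tangent; lra.
Qed.

(** If all increments from M on were at least e, G would grow linearly and pass B. *)
Lemma bounded_small_increment (R : realType) (G : nat -> R) (B e : R) (M : nat) :
  (forall n, G n <= B) -> 0 < e -> exists2 N, (M <= N)%N & G N.+1 - G N < e.
Proof.
move=> GB e0; apply: contrapT => /forall2NP H.
have step N : (M <= N)%N -> G N + e <= G N.+1.
  by move=> MN; have [//|/negP] := H N; rewrite -leNgt => ?; lra.
have lin k : G M + k%:R * e <= G (M + k)%N.
  elim: k => [|k IHk]; first by rewrite mul0r addr0 addn0.
  by rewrite addnS; have := step (M + k)%N (leq_addr _ _); rewrite -natr1; lra.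
have := lin (Num.Def.truncn ((B - G M) / e)).+1.
have := truncnS_gt ((B - G M) / e).
rewrite ltr_pdivrMr// => h1 h2.
by have := GB (M + (Num.Def.truncn ((B - G M) / e)).+1)%N; lra.
Qed.

(** * Second differences tested against ramps *)

Section DiscreteLaplacian.
Variables (R : realType) (u G : nat -> R).
(** In the application u is the change of the densities over [0, t] and G the time-integrated flux.
    [u0] is the formula [uS] continued to index 0 with G vanishing at 0 and -1. *)
Hypotheses (G0 : G 0%N = 0) (u0 : u 0%N = G 1%N).
Hypothesis uS : forall j, u j.+1 = G j.+2 - G j.+1 - G j.+1 + G j.

Lemma sum_laplacian n : \sum_(j < n.+1) u j = G n.+1 - G n.
Proof.
elim: n => [|n IHn]; first by rewrite big_ord1 u0 G0 subr0.
by rewrite big_ord_recr/= IHn uS; ring.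
Qed.

(** Truncated subtraction makes the weight (i - j)_+, whose second difference is the unit mass at i;
    it vanishes for j >= i, so no boundary term arises at n. Raising i by one adds a plain partial
    sum, which is G (i+1) - G i. *)
Lemma sum_tent_laplacian i n : (i <= n)%N ->
  \sum_(j < n) (i - j)%:R * u j = G i.
Proof.
move=> /subnKC <-; elim: (n - i)%N => {n} [|k IHk].
  rewrite addn0; elim: i => [|i IHi]; first by rewrite big_ord0 G0.
  transitivity (\sum_(j < i.+1) u j + \sum_(j < i.+1) (i - j)%:R * u j).
    rewrite -big_split/=; apply: eq_bigr => j _.
    by rewrite subSn -1?ltnS// -natr1; ring.
  by rewrite sum_laplacian big_ord_recr/= subnn mul0r addr0 IHi subrK.
rewrite addnS big_ord_recr/= IHk.
have /eqP -> : (i - (i + k) == 0)%N by rewrite subn_eq0 leq_addr.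
by rewrite mul0r addr0.
Qed.

(** Follows from (j - i)_+ = j - i + (i - j)_+. *)
Lemma sum_ramp_laplacian i n : (i <= n.+1)%N ->
  \sum_(j < n.+1) (j - i)%:R * u j =
  \sum_(j < n.+1) j%:R * u j - i%:R * (G n.+1 - G n) + G i.
Proof.
move=> /sum_tent_laplacian <-; rewrite -sum_laplacian mulr_sumr -sumrB -big_split/=.
apply: eq_bigr => j _; rewrite -!mulrBl -mulrDl; congr (_ * _).
have : (j - i + i = j + (i - j))%N by lia.
by move=> /(congr1 (fun k => k%:R : R)); rewrite !natrD => h; lra.
Qed.

End DiscreteLaplacian.

(* The ramps (j - i)_+ are not finitely supported; truncating the sums at N leaves
   the boundary term i (G (N+1) - G N), which is at most i e for arbitrarily large
   N because G is bounded. *)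
Lemma sum_flux_le_moment (R : realType) (f g G : nat -> R) (alpha B m : R)
    (n : nat) :
  1 < alpha <= 2 -> (forall j, 0 <= f j) -> (forall j, 0 <= g j) ->
  (forall j, G j <= B) -> G 0%N = 0 -> g 0%N - f 0%N = G 1%N ->
  (forall j, g j.+1 - f j.+1 = G j.+2 - G j.+1 - G j.+1 + G j) ->
  series (fun j => j%:R * (g j - f j)) @ \oo --> (0 : R) ->
  (forall N, \sum_(j < N) j%:R `^ alpha * g j <= m) ->
  \sum_(i < n) i.+1%:R `^ (alpha - 2) * G i.+1 <= (alpha - 1)^-1 * m.
Proof.
move=> /andP[alpha1 alpha2] f0 g0 GB G0 u0 uS mass mg.
pose w i : R := i.+1%:R `^ (alpha - 2).
have w0 i : 0 <= w i by exact: powR_ge0.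
set H := \sum_(i < n) w i * (i.+2)%:R.
have H0 : 0 <= H by apply: sumr_ge0 => i _; rewrite mulr_ge0.
(* [H] depends on n but not on the truncation index N, so the error e H can be made arbitrarily
   small. *)
suff le_eps e : 0 < e ->
    \sum_(i < n) w i * G i.+1 <= (alpha - 1)^-1 * m + e * H.
  apply/ler_addgt0Pr => e e0.
  have H1 : 0 < H + 1 by rewrite ltr_wpDl.
  apply: le_trans (le_eps (e / (H + 1)) _) _; first by rewrite divr_gt0.
  by rewrite lerD2l mulrAC ler_pdivrMr// ler_wpM2l ?(ltW e0)// lerDl.
move=> e0.
have [M _ HM] : \forall N \near \oo,
    `|series (fun j => j%:R * (g j - f j)) N| < e by exact: cvgr0_norm_lt.
(* N lies beyond M, where the mass defect is below e, and beyond n, so that every ramp used starts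
   within the truncation. *)
have [N MN incr] := bounded_small_increment (maxn M n) GB e0.
(* The loss (i+2) e consists of e from the mass defect and (i+1) e from the boundary term. *)
have ramp (i : 'I_n) :
    G i.+1 - i.+2%:R * e <= \sum_(j < N.+1) (j - i.+1)%:R * g j.
  have iN : (i.+1 <= N.+1)%N.
    by rewrite (leq_trans (ltn_ord i)) ?(leq_trans (leq_maxr M n)) ?leqW.
  have := @sum_ramp_laplacian R (fun j => g j - f j) G G0 u0 uS i.+1 N iN.
  move=> ramp_eq.
  have /ltW : `|\sum_(j < N.+1) j%:R * (g j - f j)| < e.
    have := HM N.+1; rewrite /series/= big_mkord; apply.
    by rewrite (leq_trans (leq_maxl M n)) ?leqW.
  rewrite ler_norml => /andP[mass_ge _].
  have le_g : \sum_(j < N.+1) (j - i.+1)%:R * (g j - f j)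
      <= \sum_(j < N.+1) (j - i.+1)%:R * g j.
    by apply: ler_sum => j _; rewrite ler_wpM2l// gerBl.
  apply: le_trans le_g; rewrite ramp_eq.
  have : i.+1%:R * (G N.+1 - G N) <= i.+1%:R * e by rewrite ler_wpM2l// ltW.
  by rewrite -[i.+2%:R]natr1; lra.
have -> : \sum_(i < n) w i * G i.+1 =
    \sum_(i < n) w i * (G i.+1 - i.+2%:R * e) + e * H.
  by rewrite mulr_sumr -big_split/=; apply: eq_bigr => i _; ring.
rewrite lerD2r.
apply: le_trans (_ : \sum_(i < n) w i * \sum_(j < N.+1) (j - i.+1)%:R * g j <= _).
  by apply: ler_sum => i _; rewrite ler_wpM2l.
under eq_bigr do rewrite mulr_sumr.
(* With j outermost, it remains to bound the sum of w_i (j - i - 1)_+ over i by j^alpha / (alpha -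
   1). *)
rewrite exchange_big/=.
apply: le_trans (_ :
  \sum_(j < N.+1) (alpha - 1)^-1 * (j%:R `^ alpha * g j) <= _); last first.
  by rewrite -mulr_sumr ler_wpM2l// invr_ge0; lra.
apply: ler_sum => j _; under eq_bigr do rewrite mulrA.
rewrite -mulr_suml mulrA ler_wpM2r//.
have [j0|j0] := posnP j.
  rewrite j0 big1 => [|i _]; last by rewrite sub0n mulr0.
  by rewrite mulr_ge0 ?powR_ge0// invr_ge0; lra.
have alphaE : alpha - 2 = alpha - 1 - 1 by lra.
(* Only i < j contribute, and there (j - i - 1)_+ <= j; [sum_powR_le] with b = alpha - 1 bounds the
   remaining sum of weights. *)
apply: le_trans (_ : j%:R * \sum_(i < j) w i <= _); last first.
  rewrite -(@mulr_powRB1 R j%:R alpha) ?ler0n//; last by lra.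
  rewrite mulrCA ler_wpM2l// /w alphaE; apply: sum_powR_le; lra.
rewrite mulr_sumr.
apply: le_trans (_ : \sum_(i < n | (i < j)%N) j%:R * w i <= _).
  rewrite [leRHS]big_mkcond/=; apply: ler_sum => i _; case: ifPn => ij.
    by rewrite mulrC ler_wpM2r// ler_nat leq_subr.
  by have /eqP -> : (j - i.+1 == 0)%N; [rewrite subn_eq0; lia|rewrite mulr0].
rewrite -(big_mkord (fun i => (i < j)%N) (fun i => j%:R * w i)).
rewrite -(big_mkord xpredT (fun i => j%:R * w i)).
rewrite (big_nat_widenl 0 0)//= [leRHS](big_nat_widen _ _ (maxn n j)) ?leq_maxr//=.
rewrite (big_nat_widen _ _ (maxn n j)) ?leq_maxl//=.
rewrite [leLHS]big_mkcond [leRHS]big_mkcond/=; apply: ler_sum => i _.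
by case: (i < j)%N => //; case: ifP => // _; rewrite mulr_ge0.
Qed.

(** * Finite-time blow-up *)

(** The last hypothesis is a weak form of m(t) >= b times the integral of m^2. The delays between
    successive doublings form a convergent geometric series, so m would exceed every level by a
    finite time. *)
Lemma doubling_blowup (R : realType) (m : R -> R) (a b : R) :
  0 < a -> 0 < b -> (forall t, 0 <= t -> a <= m t) ->
  (forall A tau t, 0 <= A -> 0 <= tau <= t ->
    (forall s, tau <= s <= t -> A <= m s) -> b * A ^+ 2 * (t - tau) <= m t) ->
  False.
Proof.
move=> a0 b0 ma step.
(* The level a 2^n doubles within time 2 / (b a 2^n); T n sums these delays. *)
pose T n : R := 4 / (a * b) * (1 - 2^-1 ^+ n).
have ab0 : 0 < a * b by rewrite mulr_gt0.
have half1 n : (2^-1 : R) ^+ n <= 1 by rewrite exprn_ile1// invf_le1//; lra.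
have half0 n : 0 < (2^-1 : R) ^+ n by rewrite exprn_gt0// invr_gt0.
have T0 n : 0 <= T n.
  by rewrite mulr_ge0// ?subr_ge0// divr_ge0// ltW.
have dbl n t : T n <= t -> a * 2 ^+ n <= m t.
  elim: n t => [|n IHn] t Tt.
    by rewrite expr0 mulr1 ma// (le_trans (T0 0%N)).
  have Tincr : T n.+1 - T n = 2 / (a * b * 2 ^+ n).
    rewrite /T exprSr exprVn; field.
    by rewrite !gt_eqF// exprn_gt0.
  have gap0 : 0 < T n.+1 - T n by rewrite Tincr divr_gt0// mulr_gt0// exprn_gt0.
  apply: le_trans (step (a * 2 ^+ n) (T n) t _ _ _); last first.
  - by move=> s /andP[Ts _]; exact: IHn.
  - by rewrite T0/=; lra.
  - by rewrite mulr_ge0 ?exprn_ge0// ltW.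
  (* The delay is chosen so that this product equals 2 a 2^n. *)
  apply: le_trans (_ : b * (a * 2 ^+ n) ^+ 2 * (T n.+1 - T n) <= _); last first.
    by rewrite ler_wpM2l ?lerD2r// mulr_ge0 ?sqr_ge0// ltW.
  rewrite Tincr le_eqVlt; apply/orP; left; apply/eqP; rewrite exprSr; field.
  by rewrite !gt_eqF// exprn_gt0.
(* The time 4 / (a b) bounds every [T n], so m is at least a 2^n there for each n; this n makes a
   2^n >= a n exceed m. *)
pose n := (Num.Def.truncn (m (4 / (a * b)) / a)).+1.
have : a * 2 ^+ n <= m (4 / (a * b)).
  apply: dbl; rewrite /T ler_piMr ?gerBl// ?(ltW (half0 _))//.
  by rewrite divr_ge0// ltW.
have := truncnS_gt (m (4 / (a * b)) / a); rewrite ltr_pdivrMr// -/n.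
have : n%:R <= 2 ^+ n :> R by rewrite -natrX ler_nat ltnW// ltn_expl.
by rewrite -(ler_pM2l a0); lra.
Qed.

(** * Non-negative series and moments *)

Lemma nnseries_cvg_fine (R : realType) (u : nat -> R) :
  (forall k, 0 <= u k) -> (\sum_(k <oo) (u k)%:E < +oo)%E ->
  series u @ \oo --> fine (\sum_(k <oo) (u k)%:E)%E.
Proof.
move=> u0 /(nnseries_is_cvg u0) cu.
suff -> : (\sum_(k <oo) (u k)%:E)%E = (limn (series u))%:E by [].
rewrite -EFin_lim//; apply/congr_lim/funext => n /=.
by rewrite /series/= sumEFin.
Qed.

Lemma partial_sum_le_fine (R : realType) (u : nat -> R) (n : nat) :
  (forall k, 0 <= u k) -> (\sum_(k <oo) (u k)%:E < +oo)%E ->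
  \sum_(k < n) u k <= fine (\sum_(k <oo) (u k)%:E)%E.
Proof.
move=> u0 uoo; have uge0 : (forall k, (0 <= k)%N -> true -> 0 <= (u k)%:E)%E.
  by move=> k _ _; rewrite lee_fin.
rewrite -lee_fin fineK ?ge0_fin_numE ?nneseries_ge0//.
by rewrite -sumEFin -(big_mkord xpredT (EFin \o u)); exact: nneseries_lim_ge.
Qed.

Lemma natr_powR_le (R : realType) (p q : R) (j : nat) :
  0 < p -> p <= q -> j%:R `^ p <= j%:R `^ q.
Proof.
move=> p0 pq; case: j => [|j]; first by rewrite !powR0// gt_eqF//; lra.
by rewrite ler_powR// ler1n.
Qed.

Section Moments.
Variables (R : realType) (f : nat -> R).
Hypothesis f0 : forall j, 0 <= f j.
Local Open Scope ereal_scope.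

Lemma moment_term_ge0 (p : R) j : 0 <= (j%:R `^ p * f j)%:E.
Proof. by rewrite lee_fin mulr_ge0// powR_ge0. Qed.

Lemma moment_ge0 p : 0 <= moment p f.
Proof. by apply: nneseries_ge0 => j _ _; exact: moment_term_ge0. Qed.

Lemma moment_le p q : (0 < p)%R -> (p <= q)%R -> moment p f <= moment q f.
Proof.
move=> p0 pq; apply: lee_nneseries => [j _ _|j _]; first exact: moment_term_ge0.
by rewrite lee_fin ler_wpM2r// natr_powR_le.
Qed.

Lemma moment_term_le p j : (j%:R `^ p * f j)%:E <= moment p f.
Proof.
rewrite /moment (@nneseriesD1 _ _ j)//; last by move=> k _; exact: moment_term_ge0.
by rewrite leeDl//; apply: nneseries_ge0 => k _ _; exact: moment_term_ge0.
Qed.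

(** For non-negative f, a moment of positive order vanishes exactly when f_j = 0 for all j >= 1,
    whatever the order. *)
Lemma moment_gt0 p q : (0 < p)%R -> (0 < q)%R -> 0 < moment p f -> 0 < moment q f.
Proof.
move=> p0 q0; apply: contraLR; rewrite -!leNgt => Mq.
rewrite /moment eseries0// => j _ _; congr (_%:E).
case: j => [|j]; first by rewrite powR0 ?mul0r ?gt_eqF.
have := le_trans (moment_term_le q j.+1) Mq.
rewrite lee_fin pmulr_rle0 ?powR_gt0// => fj.
by rewrite (@le_anti _ _ (f j.+1) 0%R) ?mulr0// fj f0.
Qed.

Lemma moment_shift p : (0 < p)%R ->
  moment p f = \sum_(0 <= i <oo) (i.+1%:R `^ p * f i.+1)%:E.
Proof.
move=> p0; rewrite /moment nneseries_recl//; last by move=> k _; exact: moment_term_ge0.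
rewrite powR0 ?gt_eqF// mul0r add0e -(nneseries_addn 1%N); last exact: moment_term_ge0.
by apply: eq_eseriesr => i _; rewrite addn1.
Qed.

End Moments.

(** * Rates and fluxes for the given kernel *)

Section Kernel.
Variables (R : realType) (K : nat -> nat -> R) (alpha C C1 : R).
Hypotheses (symK : symmetric_kernel K) (alpha12 : 1 < alpha <= 2).
Hypotheses (C0 : 0 < C) (C10 : 0 < C1).
Hypothesis boundsK : forall j k : nat,
  C1 * (j%:R ^+ 2 * k%:R `^ alpha + j%:R `^ alpha * k%:R ^+ 2) <= K j k
    <= C * j%:R ^+ 2 * k%:R ^+ 2.

Let alpha_gt0 : 0 < alpha. Proof. by case/andP: alpha12 => *; lra. Qed.

Lemma kernel_ge0 j k : 0 <= K j k.
Proof.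
case/andP: (boundsK j k) => + _; apply: le_trans.
by rewrite mulr_ge0 ?(ltW C10)// addr_ge0// mulr_ge0// powR_ge0.
Qed.

Lemma kernelr0 j : K j 0%N = 0.
Proof.
case/andP: (boundsK j 0%N) => _; rewrite expr0n mulr0 => K0.
by apply/le_anti; rewrite K0 kernel_ge0.
Qed.

Section Rates.
Variable f : nat -> R.
Hypothesis f0 : forall j, 0 <= f j.
Local Open Scope ereal_scope.

Lemma export_rate_ge0 j : 0 <= export_rate K f j.
Proof. by apply: nneseries_ge0 => k _ _; rewrite lee_fin mulr_ge0// kernel_ge0. Qed.

(** The term k = 0 missing on the left vanishes on the right, and symmetry swaps the indices of the
    others. *)
Lemma import_rateE j : import_rate K f j = export_rate K f j.
Proof.
rewrite /export_rate nneseries_recl//; last first.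
  by move=> k _; rewrite lee_fin mulr_ge0// kernel_ge0.
by rewrite kernelr0 mul0r add0e; apply: eq_eseriesr => k _; rewrite symK.
Qed.

Lemma export_rate0 : export_rate K f 0 = 0.
Proof. by rewrite /export_rate eseries0// => k _ _; rewrite symK kernelr0 mul0r. Qed.

Lemma export_rate_le j : export_rate K f j <= (C * j%:R ^+ 2)%:E * moment 2%R f.
Proof.
rewrite -nneseriesZl; last by move=> k _; exact: moment_term_ge0.
apply: lee_nneseries => [k _ _|k _].
  by rewrite lee_fin mulr_ge0// kernel_ge0.
rewrite -EFinM lee_fin mulrA ler_wpM2r// powR_mulrn//.
by case/andP: (boundsK j k).
Qed.

Lemma export_rate_lower j :
  (C1 * j%:R ^+ 2)%:E * moment alpha f <= export_rate K f j.
Proof.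
rewrite -nneseriesZl; last by move=> k _; exact: moment_term_ge0.
apply: lee_nneseries => [k _ _|k _].
  by rewrite -EFinM lee_fin !mulr_ge0 ?exprn_ge0 ?powR_ge0// ltW.
rewrite -EFinM lee_fin mulrA ler_wpM2r//.
case/andP: (boundsK j k) => + _; apply: le_trans.
by rewrite -mulrA ler_wpM2l ?(ltW C10)// lerDl mulr_ge0// powR_ge0.
Qed.

(** The quantity g_j of the diffusion form: by [import_rateE] it is both the export and the import
    term of size j. *)
Definition flux j : \bar R := (f j)%:E * export_rate K f j.

Lemma flux_ge0 j : 0 <= flux j.
Proof. by apply: mule_ge0; [rewrite lee_fin|exact: export_rate_ge0]. Qed.

Lemma flux0 : flux 0 = 0. Proof. by rewrite /flux export_rate0 mule0. Qed.

(** The factor j^2 of the rate is absorbed by j^2 f_j <= M_2(f), so the bound is uniform in j. *)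
Lemma flux_le (B : R) j : moment 2%R f <= B%:E -> flux j <= (C * B ^+ 2)%:E.
Proof.
move=> fB.
have jB : (j%:R ^+ 2 * f j <= B)%R.
  rewrite -powR_mulrn// -lee_fin; apply: le_trans fB.
  exact: moment_term_le.
have B0 : (0 <= B)%R by rewrite (le_trans _ jB)// mulr_ge0.
apply: (@le_trans _ _ ((f j)%:E * ((C * j%:R ^+ 2)%:E * B%:E))).
  rewrite lee_wpmul2l// ?lee_fin//; apply: le_trans (export_rate_le j) _.
  by rewrite lee_wpmul2l// lee_fin mulr_ge0// ltW.
rewrite -!EFinM lee_fin.
have -> : (f j * (C * j%:R ^+ 2 * B) = C * B * (j%:R ^+ 2 * f j))%R by ring.
by rewrite (expr2 B) [leRHS]mulrA ler_wpM2l// mulr_ge0// ltW.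
Qed.

(** Since g_i >= C1 i^2 f_i M_alpha(f), the weight i^(alpha-2) restores i^alpha f_i, which sums to a
    second factor M_alpha(f). *)
Lemma sum_flux_ge : (moment alpha f < +oo) ->
  C1%:E * moment alpha f * moment alpha f <=
  \sum_(0 <= i <oo) (i.+1%:R `^ (alpha - 2))%:E * flux i.+1.
Proof.
move=> Moo; set M := fine (moment alpha f).
have ME : moment alpha f = M%:E by rewrite fineK// ge0_fin_numE ?moment_ge0.
have M0 : (0 <= M)%R by rewrite fine_ge0// moment_ge0.
rewrite [X in _ * X <= _](moment_shift f0 alpha_gt0) ME -EFinM -nneseriesZl; last first.
  by move=> i _; exact: (moment_term_ge0 f0 alpha i.+1).
apply: lee_nneseries => [i _ _|i _].
  by rewrite -EFinM lee_fin !mulr_ge0 ?powR_ge0// ltW.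
have /(lee_wpmul2l (_ : 0 <= (i.+1%:R `^ (alpha - 2) * f i.+1)%:E)) :=
  export_rate_lower i.+1.
rewrite lee_fin mulr_ge0 ?powR_ge0// => /(_ isT).
move=> flux_lower; rewrite /flux [leRHS]muleA -EFinM.
apply: le_trans flux_lower; rewrite ME -!EFinM lee_fin -powR_mulrn//.
have -> : (i.+1%:R `^ alpha = i.+1%:R `^ (alpha - 2) * i.+1%:R `^ 2 :> R)%R.
  by rewrite -powRD ?subrK// pnatr_eq0 implybT.
by rewrite le_eqVlt; apply/orP; left; apply/eqP; ring.
Qed.

Lemma edg_rhs0 : edg_rhs K f 0 = flux 1.
Proof. by rewrite /= import_rateE export_rate0 mule0 sube0. Qed.

Lemma edg_rhsS j :
  edg_rhs K f j.+1 = flux j.+2 - flux j.+1 - flux j.+1 + flux j.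
Proof. by rewrite /= !import_rateE. Qed.

End Rates.

(** * Time-integrated fluxes and moment growth along a solution *)

Section Solution.
Variables (f_init : nat -> R) (T : R) (f : R -> nat -> R).
Hypothesis sol : edg_solution K f_init T f.

Let fge0 t : 0 <= t < T -> forall j, 0 <= f t j.
Proof.
by move=> tT; have [] : Yplus 2 (f t) by apply: (edg_Y2 sol); rewrite in_itv.
Qed.

Let earlier t s : 0 <= t < T -> `[0, t]%classic s -> 0 <= s < T.
Proof. by move=> /andP[_ tT]; rewrite /= in_itv/= => /andP[-> /le_lt_trans->]. Qed.

Lemma moment2_bounded :
  exists2 B : R, 0 <= B & forall t, 0 <= t < T -> (moment 2%R (f t) <= B%:E)%E.
Proof.
have := edg_bounded sol; set S := [set _ | _ in _] => Soo.
exists (Num.max 0 (fine (ereal_sup S))); first by rewrite le_max lexx.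
move=> t tT; have : (moment 2%R (f t) <= ereal_sup S)%E.
  by apply: ereal_sup_ubound; exists t => //=; rewrite in_itv.
have := moment_ge0 (fge0 tT) 2.
case: (ereal_sup S) Soo => [r _ _|//|_ M0]; last first.
  by rewrite leeNy_eq => /eqP M_Ny; rewrite M_Ny in M0.
by move=> /le_trans; apply; rewrite lee_fin le_max lexx orbT.
Qed.

Lemma moment_alpha_lty t : 0 <= t < T -> (moment alpha (f t) < +oo)%E.
Proof.
move=> tT; have [_] : Yplus 2 (f t) by apply: (edg_Y2 sol); rewrite in_itv.
apply: le_lt_trans; apply: moment_le => //; first exact: fge0.
by case/andP: alpha12.
Qed.

Lemma measurable_density j t : 0 <= t < T -> measurable_fun `[0, t] (fun s => f s j).
Proof.
move=> tT; apply: (@measurable_funS _ _ _ _ `[0, T[) => //.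
  by move=> s /(earlier tT); rewrite /= in_itv.
by apply: subspace_continuous_measurable_fun => //; exact: (edg_continuous sol).
Qed.

Local Open Scope ereal_scope.

Lemma measurable_flux j t : (0 <= t < T)%R ->
  measurable_fun `[0%R, t] (fun s => flux (f s) j).
Proof.
move=> tT; apply: emeasurable_funM.
  by apply/measurable_EFinP; exact: measurable_density.
apply: ge0_emeasurable_sum => [k s /(earlier tT) s0T _|k _].
  by rewrite lee_fin mulr_ge0 ?kernel_ge0// fge0.
apply/measurable_EFinP; apply: measurable_funM => //.
exact: measurable_density.
Qed.

(** The bound of [flux_le] is uniform in time and the interval has finite length. Integrability
    allows the integrated equation to be split into single fluxes. *)
Lemma integrable_flux j t : (0 <= t < T)%R ->
  lebesgue_measure.-integrable `[0%R, t] (fun s => flux (f s) j).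
Proof.
move=> tT; have [B B0 fB] := moment2_bounded.
apply: (@le_integrable _ _ _ _ _ _ _ (EFin \o cst (C * B ^+ 2)%R)) => //.
- exact: measurable_flux.
- move=> s /(earlier tT) s0T; rewrite gee0_abs; last exact/flux_ge0/fge0.
  rewrite /= ger0_norm ?mulr_ge0 ?sqr_ge0 ?(ltW C0)//.
  by apply: flux_le; [exact: fge0|exact: fB].
- apply: measurable_bounded_integrable => //; last exact: bounded_cst.
  by rewrite /= lebesgue_measure_itv/=; case: ifPn => // _; rewrite -EFinB ltry.
Qed.

(** Real-valued, to serve as G in the summation by parts; [fine] loses nothing for t in [0, T),
    where the integral is finite. *)
Definition cumulative_flux t j : R :=
  fine (\int[lebesgue_measure]_(s in `[0%R, t]) flux (f s) j).

Lemma cumulative_fluxE t j : (0 <= t < T)%R ->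
  (cumulative_flux t j)%:E = \int[lebesgue_measure]_(s in `[0%R, t]) flux (f s) j.
Proof. by move=> tT; rewrite fineK// integrable_fin_num//; exact: integrable_flux. Qed.

Lemma edg_cumulative0 t : (0 <= t < T)%R ->
  (f t 0 - f 0 0 = cumulative_flux t 1)%R.
Proof.
move=> tT; have := edg_equation sol 0%N (t := t); rewrite in_itv => /(_ tT).
under eq_integral.
  move=> s; rewrite inE => /(earlier tT)/fge0 fs0.
  rewrite edg_rhs0//.
  over.
by rewrite -cumulative_fluxE// -EFinD => -[->]; rewrite addrC addKr.
Qed.

Lemma edg_cumulativeS t j : (0 <= t < T)%R ->
  (f t j.+1 - f 0 j.+1 = cumulative_flux t j.+2 - cumulative_flux t j.+1
    - cumulative_flux t j.+1 + cumulative_flux t j)%R.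
Proof.
move=> tT; have := edg_equation sol j.+1 (t := t); rewrite in_itv => /(_ tT).
under eq_integral.
  move=> s; rewrite inE => /(earlier tT)/fge0 fs0.
  rewrite edg_rhsS//.
  over.
have itg := integrable_flux ^~ t ^~ tT.
rewrite integralD//; last by apply: integrableB => //; exact: integrableB.
rewrite integralB//; last by apply: integrableB.
rewrite integralB// -!cumulative_fluxE// -!EFinB -!EFinD => -[->].
by rewrite [LHS]addrAC subrr add0r.
Qed.

Lemma cumulative_flux0 t : (0 <= t < T)%R -> cumulative_flux t 0 = 0%R.
Proof.
move=> tT; rewrite /cumulative_flux integral0_eq// => s _; exact: flux0.
Qed.

Lemma cumulative_flux_bounded t : (0 <= t < T)%R ->
  exists B, forall j, (cumulative_flux t j <= B)%R.
Proof.
move=> tT; have [B B0 fB] := moment2_bounded; have [t0 tT'] := andP tT.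
exists (C * B ^+ 2 * t)%R => j; rewrite -lee_fin cumulative_fluxE//.
apply: (@le_trans _ _ (\int[lebesgue_measure]_(s in `[0%R, t]) (C * B ^+ 2)%:E)).
  apply: ge0_le_integral => //.
  - by move=> s /(earlier tT) s0T; apply/flux_ge0/fge0.
  - exact: measurable_flux.
  - by move=> s /(earlier tT) s0T; apply: flux_le; [exact: fge0|exact: fB].
rewrite integral_cst//= lebesgue_measure_itv/= lte_fin.
case: ifPn => [_|]; first by rewrite sube0 EFinM.
by rewrite -leNgt => t0'; rewrite mule0 lee_fin !mulr_ge0// ltW.
Qed.

(** The first moments are finite, being at most M_alpha, so both mass series converge in the reals
    and their limits cancel. *)
Lemma series_mass_cvg0 t : (0 <= t < T)%R -> moment 1%R (f t) = moment 1%R (f 0) ->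
  series (fun j => j%:R * (f t j - f 0 j))%R @ \oo --> (0 : R)%R.
Proof.
move=> tT mass; have [t0 tT'] := andP tT.
have cvg_mass s : (0 <= s < T)%R ->
    series (fun j => j%:R * f s j)%R @ \oo --> fine (moment 1%R (f s)).
  move=> sT; have M1 : moment 1%R (f s) = \sum_(0 <= j <oo) (j%:R * f s j)%:E.
    by apply: eq_eseriesr => j _; rewrite powRr1.
  rewrite M1; apply: nnseries_cvg_fine => [k|]; first by rewrite mulr_ge0// fge0.
  rewrite -M1; apply: le_lt_trans (moment_alpha_lty sT).
  by apply: moment_le => //; [exact: fge0|case/andP: alpha12 => /ltW].
have T0 : (0 <= 0 :> R)%R && (0 < T)%R by rewrite lexx (le_lt_trans t0).
have -> : series (fun j => j%:R * (f t j - f 0 j))%R =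
    (series (fun j => j%:R * f t j) - series (fun j => j%:R * f 0 j))%R.
  apply/funext => n; rewrite /series/= -[RHS]/(_ - _)%R -sumrB.
  by apply: eq_bigr => j _; rewrite mulrBr.
have := cvgB (cvg_mass t tT) (cvg_mass 0%R T0).
by rewrite mass subrr; apply.
Qed.

(** Integral and sum are exchanged by non-negativity; each partial sum is then bounded by
    [sum_flux_le_moment] applied to the densities at times 0 and t. *)
Lemma integral_sum_flux_le t : (0 <= t < T)%R ->
  moment 1%R (f t) = moment 1%R (f 0) ->
  \int[lebesgue_measure]_(s in `[0%R, t])
     (\sum_(0 <= i <oo) (i.+1%:R `^ (alpha - 2))%:E * flux (f s) i.+1) <=
  (alpha - 1)^-1%:E * moment alpha (f t).
Proof.
move=> tT mass; have [t0 tT'] := andP tT.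
have T0 : (0 <= 0 :> R)%R && (0 < T)%R by rewrite lexx (le_lt_trans t0).
rewrite integral_nneseries//; last 2 first.
- by move=> i; apply: emeasurable_funM => //; exact: measurable_flux.
- move=> i s /(earlier tT) s0T; rewrite mule_ge0 ?lee_fin ?powR_ge0//.
  exact/flux_ge0/fge0.
apply: lime_le.
  apply: is_cvg_nneseries => i _ _; apply: integral_ge0 => s /(earlier tT) s0T.
  by rewrite mule_ge0 ?lee_fin ?powR_ge0//; exact/flux_ge0/fge0.
apply: nearW => n; rewrite big_mkord.
have [B GB] := cumulative_flux_bounded tT.
have Mfin : moment alpha (f t) \is a fin_num.
  by rewrite ge0_fin_numE ?moment_alpha_lty// moment_ge0//; exact: fge0.
rewrite -(fineK Mfin) -EFinM.
under eq_bigr.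
  move=> i _; rewrite ge0_integralZl//; last 2 first.
  - exact: measurable_flux.
  - by move=> s /(earlier tT) s0T; exact/flux_ge0/fge0.
  rewrite -cumulative_fluxE// -EFinM.
  over.
rewrite sumEFin lee_fin.
apply: (@sum_flux_le_moment R (f 0%R) (f t) _ alpha B) => //.
- exact: fge0.
- exact: fge0.
- exact: cumulative_flux0.
- exact: edg_cumulative0.
- by move=> j; exact: edg_cumulativeS.
- exact: series_mass_cvg0.
- move=> N; apply: partial_sum_le_fine; last exact: moment_alpha_lty.
  by move=> k; rewrite mulr_ge0 ?powR_ge0// fge0.
Qed.

(** Supplies the growth hypothesis of [doubling_blowup]: the integral is restricted to [tau, t],
    where [sum_flux_ge] makes the integrand at least C1 A^2. *)
Lemma moment_growth (A tau t : R) : (0 <= A)%R -> (0 <= tau <= t)%R -> (t < T)%R ->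
  moment 1%R (f t) = moment 1%R (f 0) ->
  (forall s, (tau <= s <= t)%R -> (A <= fine (moment alpha (f s)))%R) ->
  ((alpha - 1) * C1 * A ^+ 2 * (t - tau) <= fine (moment alpha (f t)))%R.
Proof.
move=> A0 /andP[tau0 taut] tT mass mA.
have t0T : (0 <= t < T)%R by rewrite (le_trans tau0).
have sub : `[tau, t] `<=` `[0%R, t].
  by move=> s /=; rewrite !in_itv/= => /andP[/(le_trans tau0)-> ->].
have Mfin s : (0 <= s < T)%R -> moment alpha (f s) \is a fin_num.
  by move=> s0T; rewrite ge0_fin_numE ?moment_alpha_lty// moment_ge0//; exact: fge0.
have sum_ge0 s : `[0%R, t]%classic s ->
    0 <= \sum_(0 <= i <oo) (i.+1%:R `^ (alpha - 2))%:E * flux (f s) i.+1.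
  move=> /(earlier t0T) s0T; apply: nneseries_ge0 => i _ _.
  by rewrite mule_ge0 ?lee_fin ?powR_ge0//; exact/flux_ge0/fge0.
have msum : measurable_fun `[0%R, t]
    (fun s => \sum_(0 <= i <oo) (i.+1%:R `^ (alpha - 2))%:E * flux (f s) i.+1).
  apply: ge0_emeasurable_sum => [i s /(earlier t0T) s0T _|i _].
    by rewrite mule_ge0 ?lee_fin ?powR_ge0//; exact/flux_ge0/fge0.
  by apply: emeasurable_funM => //; exact: measurable_flux.
have : (C1 * A ^+ 2 * (t - tau))%:E <= (alpha - 1)^-1%:E * moment alpha (f t).
  apply: le_trans (integral_sum_flux_le t0T mass).
  apply: le_trans (_ : \int[lebesgue_measure]_(s in `[tau, t])
      (\sum_(0 <= i <oo) (i.+1%:R `^ (alpha - 2))%:E * flux (f s) i.+1) <= _);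
    last first.
    exact: ge0_subset_integral.
  apply: (@le_trans _ _ (\int[lebesgue_measure]_(s in `[tau, t]) (C1 * A ^+ 2)%:E)).
    rewrite integral_cst//= lebesgue_measure_itv/= lte_fin.
    case: ifPn => [_|]; first by rewrite -EFinB EFinM.
    rewrite -leNgt => tle; have -> : t = tau by apply/le_anti; rewrite tle taut.
    by rewrite subrr mulr0 mule0.
  apply: ge0_le_integral => //.
  - by move=> s _; rewrite lee_fin mulr_ge0 ?sqr_ge0// ltW.
  - exact: measurable_funS msum.
  - move=> s ts; have s0T := earlier t0T (sub _ ts).
    apply: le_trans (sum_flux_ge (fge0 s0T) (moment_alpha_lty s0T)).
    have := mA s; move: ts; rewrite /= in_itv/= => -> /(_ isT) As.
    rewrite -(fineK (Mfin _ s0T)) -!EFinM lee_fin -mulrA ler_wpM2l ?(ltW C10)//.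
    by rewrite -expr2 ler_pXn2r// nnegrE ?(le_trans A0).
have a1 : (0 < alpha - 1)%R by case/andP: alpha12; lra.
rewrite -(fineK (Mfin _ t0T)) -EFinM lee_fin ler_pdivlMl//.
by rewrite !mulrA.
Qed.

End Solution.
End Kernel.

Theorem corollary2p8 (R : realType) (K : nat -> nat -> R) (alpha C C1 : R)
    (f0 : nat -> R)
    (hK : symmetric_kernel K)
    (halpha : 1 < alpha <= 2)
    (hC : 0 < C) (hC1 : 0 < C1)
    (hKbounds : forall j k : nat,
      C1 * (j%:R ^+ 2 * k%:R `^ alpha + j%:R `^ alpha * k%:R ^+ 2) <= K j k
        <= C * j%:R ^+ 2 * k%:R ^+ 2)
    (hM : (0 < moment alpha f0)%E)
    (hf0 : Yplus (2 + alpha) f0) :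
  ~ exists f : R -> nat -> R,
      edg_global_solution K f0 f /\ mass_conserving f.
Proof.
move=> [f [global mass]]; have [alpha1 alpha2] := andP halpha.
(* The horizon t + 1 puts t inside the half-open interval of existence. *)
have solT t : 0 <= t -> edg_solution K f0 (t + 1) f /\ 0 <= t < t + 1.
  by move=> t0; split; [apply: global; lra|apply/andP; split; lra].
have fge0 t : 0 <= t -> forall j, 0 <= f t j.
  move=> /solT[sol tT].
  by have [] : Yplus 2 (f t) by apply: (edg_Y2 sol); rewrite in_itv.
have Mlty t : 0 <= t -> (moment alpha (f t) < +oo)%E.
  by move=> /solT[sol tT]; exact: (moment_alpha_lty halpha sol tT).
have f_init : f 0 = f0 by have [sol _] := solT 0 (lexx _); exact: (edg_init sol).
have M1_gt0 : (0 < moment 1%R (f 0%R))%E.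
  by apply: (@moment_gt0 R (f 0) (fge0 0 (lexx _)) alpha) => //; [lra|rewrite f_init].
(* Mass conservation turns the initial mass into a lower bound for M_alpha at all times, the
   starting level of the doubling. *)
have M1_le t : 0 <= t -> (moment 1%R (f 0%R) <= moment alpha (f t))%E.
  by move=> t0; rewrite -(mass t t0); apply: moment_le; [exact: fge0| |exact: ltW].
have M1fin : moment 1%R (f 0) \is a fin_num.
  by rewrite ge0_fin_numE ?(ltW M1_gt0)// (le_lt_trans (M1_le 0%R (lexx _)))// Mlty.
apply: (@doubling_blowup R (fun t => fine (moment alpha (f t)))
  (fine (moment 1%R (f 0))) ((alpha - 1) * C1)).
- by rewrite fine_gt0// M1_gt0 -ge0_fin_numE ?(ltW M1_gt0).
- by rewrite mulr_gt0// subr_gt0.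
- move=> t t0; rewrite fine_le ?M1_le// ge0_fin_numE ?Mlty//.
  exact: (le_trans (ltW M1_gt0) (M1_le t t0)).
- move=> A tau t A0 /[dup] taut /andP[tau0 taut'].
  have t0 := le_trans tau0 taut'; have [sol /andP[_ tT]] := solT t t0.
  by apply: (moment_growth hK halpha hC hC1 hKbounds sol A0 taut tT); exact: mass.
Qed.
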